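(* Let $k\geqslant 2$ be an integer and let $K(z)=\sum_{n\geqslant 0}\kappa(n)z^n$, where $\kappa$ is the sequence defined in the context. Then, as an identity of formal power series (equivalently of analytic functions on $|z|<1$), $$K(z)-\left(\sum_{a=0}^{k-1}(a+1)z^a\right)K(z^k)-\left(\sum_{a=0}^{k^2-1}z^a\right)K(z^{k^2})=-\sum_{n=0}^{k-1}z^n.$$
   Context: Fix an integer $k\geqslant 2$. For $i\in\{0,1,\ldots,k-1\}$ let $\mathbf{A}_i=\begin{pmatrix} i+1&1\\ 1&0\end{pmatrix}$. For an integer $n\geqslant 0$ with standard base-$k$ expansion $(n)_k=i_s\cdots i_1i_0$ (no leading zeros; the empty word for $n=0$), define $\kappa(n)=[1\ 0]\,\mathbf{A}_{i_0}\mathbf{A}_{i_1}\cdots\mathbf{A}_{i_s}\,[1\ 0]^T$, the empty product being the identity matrix (so $\kappa(0)=1$). *)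

(* Defs.v *)
From HB Require Import structures.
From mathcomp Require Import all_boot all_order all_algebra.
From mathcomp Require Import all_classical all_reals all_analysis.
From mathcomp Require Import complex.
Set Implicit Arguments. Unset Strict Implicit. Unset Printing Implicit Defensive.
Import Order.TTheory GRing.Theory Num.Theory.
Import numFieldNormedType.Exports.
Local Open Scope classical_set_scope.
Local Open Scope ring_scope.

(* The fuel n suffices since n %/ k < n for 1 < k and 0 < n. *)
Fixpoint digits_rec (fuel k n : nat) : seq nat :=
  if fuel is f.+1 then
    if n == 0%N then [::] else (n %% k)%N :: digits_rec f k (n %/ k)
  else [::].

(* Base-k digits of n, least significant first: [:: i_0; i_1; ...; i_s]. *)
Definition digits (k n : nat) : seq nat := digits_rec n k n.

Lemma digits_recP (k fuel n : nat) : (1 < k)%N -> (n <= fuel)%N ->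
  [/\ all (fun d => (d < k)%N) (digits_rec fuel k n),
      last 1%N (digits_rec fuel k n) != 0%N
    & foldr (fun d m => (d + k * m)%N) 0%N (digits_rec fuel k n) = n].
Proof.
move=> k1; have k0 : (0 < k)%N by exact: ltnW.
elim: fuel n => [|f IH] [|n] //= lenf.
have lt1 : (n.+1 %/ k <= f)%N.
  by rewrite -ltnS; apply: leq_trans lenf; exact: ltn_Pdiv.
have [al la va] := IH _ lt1; split.
- by rewrite ltn_mod k0.
- move: la va; case: (digits_rec _ _ _) => [_ /= d0|//].
  by have := divn_eq n.+1 k; rewrite -d0 mul0n add0n => <-.
- by rewrite va addnC mulnC -divn_eq.
Qed.

(* Specification of the standard expansion; here foldr evaluates the word, and
   the default value 1 of [last] is only used for the empty word. *)
Lemma digitsP (k n : nat) : (1 < k)%N ->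
  [/\ all (fun d => (d < k)%N) (digits k n),
      last 1%N (digits k n) != 0%N
    & foldr (fun d m => (d + k * m)%N) 0%N (digits k n) = n].
Proof. by move=> k1; exact: digits_recP. Qed.

Definition Amx (i : nat) : 'M[int]_2 :=
  \matrix_(r < 2, c < 2) nth 0 (nth [::] [:: [:: i.+1%:Z; 1];
                                             [:: 1;       0]] r) c.

Definition e1 : 'rV[int]_2 := \row_(c < 2) nth 0 [:: 1; 0] c.

Definition kappa (k n : nat) : int :=
  (e1 *m (\prod_(i <- digits k n) Amx i) *m e1^T) 0 0.

(* The ring R[[z]]: f n is the coefficient of z^n.  A separate alias of
   nat -> R, on which the library puts the pointwise product. *)
Definition fps (R : comNzRingType) : Type := nat -> R.

Section FpsRing.
Variable R : comNzRingType.
Implicit Types f g h : fps R.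

HB.instance Definition _ := GRing.Zmodule.copy (fps R) (nat -> R).

Definition fps_one : fps R := fun n => (n == 0%N)%:R.

Definition fps_mul f g : fps R := fun n => \sum_(i < n.+1) f i * g (n - i)%N.

Let trunc N f : {poly R} := \poly_(i < N.+1) f i.

Let coef_trunc N f n : (n <= N)%N -> (trunc N f)`_n = f n.
Proof. by move=> le_nN; rewrite coef_poly ltnS le_nN. Qed.

Let fps_mul_trunc N f g n : (n <= N)%N ->
  fps_mul f g n = (trunc N f * trunc N g)`_n.
Proof.
move=> le_nN; rewrite coefM; apply: eq_bigr => i _.
have le_in : (i <= n)%N by rewrite -ltnS.
by rewrite !coef_trunc ?(leq_trans _ le_nN) ?leq_subr.
Qed.

Fact fps_mulC : commutative fps_mul.
Proof.
by move=> f g; apply/funext => n; rewrite !(fps_mul_trunc _ _ (leqnn n)) mulrC.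
Qed.

Fact fps_mulA : associative fps_mul.
Proof.
move=> f g h; apply/funext => n.
transitivity ((trunc n f * (trunc n g * trunc n h))`_n); last first.
  rewrite mulrA coefM; apply: eq_bigr => i _.
  by rewrite -fps_mul_trunc -1?ltnS // coef_trunc ?leq_subr.
rewrite coefM; apply: eq_bigr => i _.
by rewrite -fps_mul_trunc ?leq_subr // coef_trunc // -ltnS.
Qed.

Fact fps_mul1 : left_id fps_one fps_mul.
Proof.
move=> f; apply/funext => n.
rewrite /fps_mul big_ord_recl big1 ?addr0 /fps_one /= ?mul1r ?subn0 //.
by move=> i _; rewrite mul0r.
Qed.

Fact fps_mulDl : left_distributive fps_mul +%R.
Proof.
move=> f g h; apply/funext => n.
transitivity (fps_mul f h n + fps_mul g h n) => //.
by rewrite -big_split; apply: eq_bigr => i _; exact: mulrDl.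
Qed.

Fact fps_oner_neq0 : fps_one != 0 :> fps R.
Proof.
apply/eqP => /(congr1 (fun f : nat -> R => f 0%N)).
by apply/eqP; exact: oner_neq0.
Qed.

HB.instance Definition _ := GRing.Zmodule_isComNzRing.Build (fps R)
  fps_mulA fps_mulC fps_mul1 fps_mulDl fps_oner_neq0.

Definition fpsX : fps R := fun n => (n == 1%N)%:R.

(* f(z^m), meaningful for 0 < m. *)
Definition fps_expand (m : nat) f : fps R :=
  fun n => if (m %| n)%N then f (n %/ m)%N else 0.

End FpsRing.
Arguments fpsX {R}.

Definition Kfps (k : nat) : fps int := kappa k.

(* Complex numbers as a numFieldType, so that the library's norm topology on
   numeric fields applies. *)
Definition cplx (R : realType) : numFieldType := R[i]%C.

Definition Kseries (R : realType) (k : nat) (z : cplx R) : (cplx R)^nat :=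
  series (fun n => (kappa k n)%:~R * z ^+ n).

(* [lim] is total; the value is meaningful where Kseries converges. *)
Definition Kfun (R : realType) (k : nat) (z : cplx R) : cplx R :=
  limn (Kseries k z).

(* Main.v *)
Require Import Defs.
From HB Require Import structures.
From mathcomp Require Import all_boot all_order all_algebra.
From mathcomp Require Import all_classical all_reals all_analysis.
From mathcomp Require Import complex.
From mathcomp Require Import zify ring lra.
Set Implicit Arguments. Unset Strict Implicit. Unset Printing Implicit Defensive.
Import Order.TTheory GRing.Theory Num.Theory.
Import numFieldNormedType.Exports.
Local Open Scope classical_set_scope.
Local Open Scope ring_scope.

(** If [n = k m + i] with [0 <= i < k], peeling off the lowest digit of [n]
    multiplies the column vector of [m] on the left by [A_i]; doing this twice
    gives
      kappa(n) = (i + 1) kappa(m) + kappa(n div k^2) - [n < k],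
    which is the identity of formal power series read off coefficientwise.  The
    recurrence yields [0 <= kappa(n) <= (n + 1)^2], hence convergence on the
    open unit disc.  Summed up to [k^2 N] it gives the functional equation for
    the partial sums of length [k^2 N], [k N] and [N], and then [N] tends to
    infinity. *)

(** * Digit recursion, and the recurrence and growth of [kappa] *)

Lemma digits_rec_fuel (k f g n : nat) : (1 < k)%N -> (n <= f)%N -> (n <= g)%N ->
  digits_rec f k n = digits_rec g k n.
Proof.
move=> k1; elim: f g n => [|f IH] [|g] [|n] //= nf ng.
have lt : (n.+1 %/ k <= n)%N by rewrite -ltnS ltn_Pdiv.
by rewrite (IH g) // (leq_trans lt).
Qed.

Lemma digitsS (k n : nat) : (1 < k)%N -> (0 < n)%N ->
  digits k n = (n %% k)%N :: digits k (n %/ k).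
Proof.
case: n => // n k1 _; rewrite /digits /=; congr (_ :: _).
(* The recursive call carries fuel [n], while [digits] would start with fuel [n.+1 %/ k]; both
   suffice. *)
by apply: digits_rec_fuel; rewrite // -ltnS ltn_Pdiv.
Qed.

(** The second row of [Amx d] copies the upper entry down. For [n > 0] the lower entry thus
    remembers the value at [n %/ k], which is the source of the two-step term
    [kappa k (n %/ k ^ 2)]. *)
Lemma mul_Amx (d : nat) (v : 'cV[int]_2) :
  (Amx d *m v) 0 0 = d.+1%:Z * v 0 0 + v 1 0 /\ (Amx d *m v) 1 0 = v 0 0.
Proof.
have lift1 : lift ord0 ord0 = 1 :> 'I_2 by apply/val_inj.
by rewrite !mxE !big_ord_recl !big_ord0 !mxE /= !mul1r !mul0r !addr0 lift1.
Qed.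

Lemma prod_digitsS (k n : nat) : (1 < k)%N -> (0 < n)%N ->
  \prod_(i <- digits k n) Amx i *m e1^T =
  Amx (n %% k) *m (\prod_(i <- digits k (n %/ k)) Amx i *m e1^T).
Proof. by move=> k1 n0; rewrite digitsS // big_cons -mulmxA. Qed.

Lemma kappaE (k n : nat) :
  kappa k n = (\prod_(i <- digits k n) Amx i *m e1^T) 0 0.
Proof.
rewrite /kappa -mulmxA; move: (_ *m e1^T) => v.
by rewrite !mxE !big_ord_recl big_ord0 !mxE /= mul1r mul0r !addr0.
Qed.

Lemma kappa0 (k : nat) : kappa k 0 = 1.
Proof.
by rewrite kappaE /digits big_nil mul1mx !mxE.
Qed.

(* The correction term comes from [kappa k 0 = 1], whereas the lower entry of
   the empty product is [0]. *)
Lemma kappa_rec (k n : nat) : (1 < k)%N ->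
  kappa k n = (n %% k + 1)%:R * kappa k (n %/ k) + kappa k (n %/ k ^ 2)
              - (n < k)%N%:R.
Proof.
move=> k1; have k0 : (0 < k)%N by exact: ltnW.
have [->|n0] := posnP n.
  by rewrite mod0n !div0n kappa0 k0 add0n mul1r addrK.
rewrite -[in RHS](mulnn k) divnMA !kappaE.
rewrite prod_digitsS // (mul_Amx _ _).1 addn1 natz -addrA; congr (_ + _).
have [ltnk|lekn] := ltnP n k.
  by rewrite (divn_small ltnk) div0n /digits big_nil !mul1mx !mxE.
have m0 : (0 < n %/ k)%N by rewrite divn_gt0.
by rewrite prod_digitsS // (mul_Amx _ _).2 subr0.
Qed.

Lemma kappa_bound (k n : nat) : (1 < k)%N -> 0 <= kappa k n <= ((n + 1) ^ 2)%:Z.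
Proof.
move=> k1; elim/ltn_ind: n => n IH.
have [->|n0] := posnP n; first by rewrite kappa0.
have m_lt := ltn_Pdiv k1 n0.
have nE := divn_eq n k.
have jk : (n %% k < k)%N by rewrite ltn_mod ltnW.
rewrite kappa_rec //.
have [ltnk|lekn] := ltnP n k.
  rewrite modn_small // !divn_small ?kappa0 //.
    by nia.
  by rewrite (leq_trans ltnk) // -mulnn leq_pmulr // ltnW.
have m0 : (0 < n %/ k)%N by rewrite divn_gt0 // ltnW.
have p_lt := ltn_Pdiv k1 m0.
have /andP[a0 ab] := IH _ m_lt.
have /andP[b0 bb] := IH _ (ltn_trans p_lt m_lt).
rewrite -mulnn divnMA subr0.
move: m0 nE jk a0 ab b0 bb p_lt {IH m_lt lekn n0}.
move: (n %/ k %/ k)%N => p; move: (n %/ k)%N (n %% k)%N => m j.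
move: (kappa k m) (kappa k p) => x y m0 -> jk x0 xb y0 yb pm.
apply/andP; split.
  by rewrite addr_ge0 // mulr_ge0.
have h1 : (j + 1)%:R * x <= ((j + 1) * (m + 1) ^ 2)%N%:Z.
  by rewrite natz PoszM ler_wpM2l.
(* Since [p < m], the bound [(p + 1) ^ 2] for [y] is at most [m ^ 2]. *)
have h2 : y <= (m ^ 2)%N%:Z.
  by rewrite (le_trans yb) // lez_nat leq_exp2r // addn1.
have h3 : ((j + 1) * (m + 1) ^ 2 + m ^ 2 <= (m * k + j + 1) ^ 2)%N.
  (* The quadratic terms in [m] are the tight ones: [j < k] and [k >= 2] give
     [j + 2 <= k + 1 <= k ^ 2]. *)
  have : ((j + 2) * m ^ 2 <= (m * k) ^ 2)%N.
    by rewrite expnMn mulnC leq_mul2l -[(k ^ 2)%N]mulnn; nia.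
  nia.
by rewrite (le_trans (lerD h1 h2)).
Qed.

(** * Coefficient extraction and the identity of formal power series *)

Section FpsCoefficients.
Variable R : comNzRingType.
Implicit Types f g h : fps R.

Lemma fps_coef_sum (I : Type) (r : seq I) (P : pred I) (F : I -> fps R) n :
  (\sum_(i <- r | P i) F i) n = \sum_(i <- r | P i) F i n.
Proof. by apply: (big_morph (fun f : fps R => f n)). Qed.

Lemma fps_coefMn f c n : (c%:R * f) n = c%:R * f n.
Proof.
rewrite !mulr_natl; elim: c => [|c IH]; first by rewrite !mulr0n.
by rewrite !mulrS -IH.
Qed.

Lemma fps_coefXM f n : (fpsX * f) n = if n is m.+1 then f m else 0.
Proof.
rewrite -[LHS]/(\sum_(i < n.+1) fpsX i * f (n - i)%N).
case: n => [|n]; first by rewrite big_ord1 mul0r.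
rewrite !big_ord_recl big1 => [|i _]; last by rewrite mul0r.
by rewrite mul0r add0r addr0 mul1r subn1.
Qed.

Lemma fps_coefXnM f a n :
  (fpsX ^+ a * f) n = if (a <= n)%N then f (n - a)%N else 0.
Proof.
elim: a n => [|a IH] n; first by rewrite mul1r subn0.
by rewrite exprS -mulrA fps_coefXM; case: n => [|n] //; rewrite IH.
Qed.

(** The summand of index [a] reaches degree [n] only if [m] divides [n - a]; among [a < m] this
    singles out [a = n %% m]. *)
Lemma fps_coef_expand_poly (c : nat -> nat) (m : nat) f n : (0 < m)%N ->
  ((\sum_(0 <= a < m) (c a)%:R * fpsX ^+ a) * fps_expand m f) n =
  (c (n %% m)%N)%:R * f (n %/ m)%N.
Proof.
move=> m0; rewrite mulr_suml fps_coef_sum.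
under eq_bigr do rewrite -mulrA fps_coefMn fps_coefXnM.
have lt_nm : (n %% m < m)%N by rewrite ltn_mod.
rewrite big_mkord (bigD1 (Ordinal lt_nm)) //= big1 ?addr0 => [|i].
  rewrite leq_mod /fps_expand.
  have -> : (n - n %% m = n %/ m * m)%N by rewrite {1}(divn_eq n m) addnK.
  by rewrite dvdn_mull // mulnK.
rewrite -val_eqE /= => ne; case: leqP => [le_in|]; last by rewrite mulr0.
rewrite /fps_expand -eqn_mod_dvd // (modn_small (ltn_ord i)).
by rewrite eq_sym (negbTE ne) mulr0.
Qed.

Lemma fps_coef_geom (m n : nat) :
  (\sum_(0 <= a < m) fpsX ^+ a : fps R) n = (n < m)%N%:R.
Proof.
rewrite fps_coef_sum.
(* The factor [1] makes [fps_coefXnM] applicable; for [a <= n] it leaves the coefficient of [1] at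
   [n - a], nonzero only for [a = n]. *)
under eq_bigr => a _ do rewrite -[fpsX ^+ a]mulr1 fps_coefXnM.
rewrite big_mkord; have [ltnm|lemn] := ltnP n m.
  rewrite (bigD1 (Ordinal ltnm)) //= big1 ?addr0 ?leqnn ?subnn // => i.
  rewrite -val_eqE /= => ne; case: leqP => // le_in.
  rewrite -[LHS]/(((n - i)%N == 0%N)%:R) subn_eq0.
  by case: leqP => // le_ni; rewrite eqn_leq le_in le_ni in ne.
apply: big1 => i _; rewrite (leq_trans (ltnW (ltn_ord i)) lemn).
rewrite -[LHS]/(((n - i)%N == 0%N)%:R) subn_eq0 leqNgt.
by rewrite (leq_trans (ltn_ord i) lemn).
Qed.

End FpsCoefficients.

Lemma Kfps_functional_equation (k : nat) : (1 < k)%N ->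
  Kfps k
    - (\sum_(0 <= a < k) (a + 1)%:R * fpsX ^+ a) * fps_expand k (Kfps k)
    - (\sum_(0 <= a < k ^ 2) fpsX ^+ a) * fps_expand (k ^ 2) (Kfps k)
  = - \sum_(0 <= n < k) fpsX ^+ n :> fps int.
Proof.
move=> k1; have k0 : (0 < k)%N by exact: ltnW.
(* Explicit coefficients [1] bring the second product into the form of [fps_coef_expand_poly] with
   [c] constant. *)
under [X in _ - X * _ = _]eq_bigr do rewrite -[fpsX ^+ _]mul1r.
apply/funext => n.
rewrite -[LHS]/(Kfps k n - (_ * _ : fps int) n - (_ * _ : fps int) n).
rewrite -[RHS]/(- (\sum_(0 <= a < k) fpsX ^+ a : fps int) n).
rewrite (fps_coef_expand_poly (fun a => (a + 1)%N)) //.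
rewrite (fps_coef_expand_poly (fun=> 1%N)) ?expn_gt0 ?k0 // fps_coef_geom mul1r.
by rewrite {1}/Kfps kappa_rec // /Kfps; ring.
Qed.

(** Writing [n = j * m + a] with [a < m] splits [z ^+ n] as [z ^+ a * (z ^+ m) ^+ j]; a range of [N]
    complete blocks makes the double sum factor exactly. *)
Lemma sum_blocks (R : comNzRingType) (c : nat -> nat) (g : nat -> R)
    (m N : nat) (z : R) : (0 < m)%N ->
  \sum_(0 <= n < N * m) (c (n %% m)%N)%:R * g (n %/ m)%N * z ^+ n =
  (\sum_(0 <= a < m) (c a)%:R * z ^+ a) *
  \sum_(0 <= j < N) g j * (z ^+ m) ^+ j.
Proof.
move=> m0; rewrite big_nat_mul mulr_sumr; apply: eq_bigr => j _.
rewrite -{1}[(j * m)%N]add0n big_addn mulSn addnK mulr_suml.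
rewrite [LHS]big_nat [RHS]big_nat; apply: eq_bigr => a /andP[_ am].
rewrite addnC modnMDl divnMDl // (modn_small am) (divn_small am) addn0.
by rewrite exprD [(j * m)%N]mulnC exprM; ring.
Qed.

(** * Convergence on the open unit disc *)

Lemma cvg_sqr_geometric (R : realType) (r : R) : 0 <= r -> r < 1 ->
  cvgn (series (fun n => ((n + 1) ^ 2)%:R * r ^+ n)).
Proof.
(* With [r = q^4], [(n+1)^2 r^n] is [((n+1) q^n)^2 (q^2)^n], and [(n+1) q^n] is
   at most the geometric sum [1 + q + ... + q^n <= 1/(1-q)]. *)
move=> r0 r1; pose q := Num.sqrt (Num.sqrt r).
have q0 : 0 <= q by exact: sqrtr_ge0.
have rE : r = q ^+ 2 ^+ 2 by rewrite !sqr_sqrtr // sqrtr_ge0.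
have q1 : q < 1.
  by rewrite -[1]sqrtr1 ltr_sqrt // -[1]sqrtr1 ltr_sqrt.
have lin n : (n + 1)%:R * q ^+ n <= (1 - q)^-1.
  rewrite -[leRHS]mul1r ler_pdivlMr ?subr_gt0 //.
  have -> : (n + 1)%:R * q ^+ n = \sum_(i < n.+1) q ^+ n.
    by rewrite sumr_const card_ord addn1 mulr_natl.
  have : \sum_(i < n.+1) q ^+ n <= \sum_(i < n.+1) q ^+ i.
    apply: ler_sum => i _; apply: ler_wiXn2l => //; first exact: ltW.
    by rewrite -ltnS.
  have qB0 : 0 <= 1 - q by rewrite subr_ge0 ltW.
  move=> /(ler_wpM2r qB0)/le_trans; apply.
  have -> : (\sum_(i < n.+1) q ^+ i) * (1 - q) = 1 - q ^+ n.+1.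
    by rewrite mulrC -[1 - q]opprB mulNr -subrX1 opprB.
  by rewrite lerBlDr lerDl exprn_ge0.
have q21 : `|q ^+ 2| < 1 by rewrite ger0_norm ?exprn_ge0 // exprn_ilt1.
have cg := is_cvg_geometric_series (a := (1 - q)^-1 ^+ 2) q21.
apply: series_le_cvg cg => n.
- by rewrite mulr_ge0 ?exprn_ge0 // ler0n.
- by rewrite /geometric /= mulr_ge0 ?exprn_ge0 // invr_ge0 subr_ge0 ltW.
- rewrite /geometric /=.
  have -> : ((n + 1) ^ 2)%:R * r ^+ n =
      ((n + 1)%:R * q ^+ n) ^+ 2 * (q ^+ 2) ^+ n.
    rewrite [in RHS]exprMn natrX -[RHS]mulrA rE -!exprM -exprD.
    by congr (_ * _); congr (_ ^+ _); lia.
  rewrite ler_wpM2r ?exprn_ge0 // ler_pXn2r ?nnegrE ?mulr_ge0 ?exprn_ge0 //.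
  by rewrite invr_ge0 subr_ge0 ltW.
Qed.

Lemma cvg_complex (R : realType) (u : (cplx R)^nat) (a b : R) :
  (fun n => complex.Re (u n)) @ \oo --> a ->
  (fun n => complex.Im (u n)) @ \oo --> b ->
  u @ \oo --> (Complex a b : cplx R).
Proof.
move=> /cvgrPdist_lt ua /cvgrPdist_lt ub.
apply/(@cvgrPdist_lt (cplx R) (cplx R)) => -[e e'].
(* In the partial order on complex numbers, a positive tolerance has imaginary part zero. *)
rewrite ltcE /= => /andP[/eqP -> e0].
have e2 : 0 < e / 2 by rewrite divr_gt0.
near=> n.
have an : `|a - complex.Re (u n)| < e / 2 by near: n; exact: ua.
have bn : `|b - complex.Im (u n)| < e / 2 by near: n; exact: ub.
rewrite normc_def; case: (u n) an bn => c d /= an bn.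
rewrite ltcR.
rewrite -(ltr_pXn2r (n := 2)) ?nnegrE ?sqrtr_ge0 ?ltW //.
rewrite sqr_sqrtr ?addr_ge0 ?sqr_ge0 //.
rewrite -(real_normK (num_real (a - c))) -(real_normK (num_real (b - d))).
have := normr_ge0 (a - c); have := normr_ge0 (b - d); nra.
Unshelve. all: by end_near. Qed.

(** Real and imaginary parts are bounded by the modulus, so each of the two real series converges
    absolutely by comparison with [w]. *)
Lemma cvg_complex_dominated (R : realType) (v : (cplx R)^nat) (w : R^nat) :
  (forall n, `|v n| <= (w n)%:C%C) -> cvgn (series w) -> cvgn (series v).
Proof.
move=> vw cw.
have key (f : {additive R[i]%C -> R}) :
    (forall x : R[i]%C, `|f x|%:C%C <= `|x|) -> cvgn (fun n => f (series v n)).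
  move=> fle.
  have -> : (fun n => f (series v n)) = series (fun n => f (v n)).
    by apply/funext => n; rewrite /series /= raddf_sum.
  apply: normed_cvg; apply: series_le_cvg cw => n.
  - exact: normr_ge0.
  - by rewrite -ler0c; exact: le_trans (normr_ge0 (v n)) (vw n).
  - by rewrite -lecR; exact: le_trans (fle _) (vw n).
have /cvg_ex[a ca] := key (@complex.Re R) (@normc_ge_Re R).
have Im_le (x : R[i]%C) : `|complex.Im x|%:C%C <= `|x|.
  case: x => a' b; rewrite normc_def lecR /= -sqrtr_sqr ler_wsqrtr //.
  by rewrite lerDr sqr_ge0.
have /cvg_ex[b cb] := key (@complex.Im R) Im_le.
by apply/cvg_ex; exists (Complex a b); exact: cvg_complex.
Qed.

Lemma Kseries_cvg (R : realType) (k : nat) (z : cplx R) : (1 < k)%N ->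
  `|z| < 1 -> cvgn (Kseries k z).
Proof.
(* The modulus lives in [cplx R]; being nonnegative, it is a real number [r], to which the real
   comparison series applies. *)
move=> k1; case zE : `|z| => [r r'].
have : 0 <= `|z| by exact: normr_ge0.
rewrite zE lecE ltcE /= => /andP[/eqP r'0 r0] /andP[_ r1]; subst r'.
apply: cvg_complex_dominated (cvg_sqr_geometric r0 r1) => n.
have /andP[K0 Kle] := kappa_bound n k1.
rewrite normrM normrX zE rmorphM rmorphXn /= rmorph_nat ler_wpM2r //.
  by rewrite exprn_ge0 // lecR.
by rewrite -intr_norm ger0_norm // [X in _ <= X]pmulrn ler_int.
Qed.

(** * Functional equation for partial sums, and passage to the limit *)

Lemma Kseries_functional_equation (R : realType) (k N : nat) (z : cplx R) :
  (1 < k)%N -> (0 < N)%N ->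
  Kseries k z (k ^ 2 * N)%N
    - (\sum_(0 <= a < k) (a + 1)%:R * z ^+ a) * Kseries k (z ^+ k) (k * N)%N
    - (\sum_(0 <= a < k ^ 2) z ^+ a) * Kseries k (z ^+ (k ^ 2)) N
  = - \sum_(0 <= n < k) z ^+ n.
Proof.
move=> k1 N0; have k0 : (0 < k)%N by exact: ltnW.
pose kap n : cplx R := (kappa k n)%:~R.
have -> : \sum_(0 <= a < k ^ 2) z ^+ a = \sum_(0 <= a < k ^ 2) 1%:R * z ^+ a.
  by apply: eq_bigr => a _; rewrite mul1r.
rewrite /Kseries /series /=.
(* Here [k * N] blocks of length [k] and [N] blocks of length [k ^ 2] both fill the range
   [n < k ^ 2 * N], so the recurrence can be summed termwise. *)
rewrite -(sum_blocks (fun a => (a + 1)%N) kap) //.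
rewrite -(sum_blocks (fun=> 1%N) kap) ?expn_gt0 ?k0 //.
rewrite mulnAC mulnn [(N * k ^ 2)%N]mulnC.
(* As [N > 0], all correction terms [n < k] lie in the common range. *)
have -> : \sum_(0 <= n < k) z ^+ n =
    \sum_(0 <= n < k ^ 2 * N) (n < k)%N%:R * z ^+ n.
  rewrite [RHS](big_cat_nat (n := k)) //=; last first.
    by rewrite -mulnn -mulnA leq_pmulr // muln_gt0 k0.
  rewrite [X in _ = _ + X]big_nat [X in _ = _ + X]big1 ?addr0; last first.
    by move=> n /andP[kn _]; rewrite ltnNge kn mul0r.
  by rewrite !big_nat; apply: eq_bigr => n /andP[_ ->]; rewrite mul1r.
rewrite -!sumrB -sumrN; apply: eq_bigr => n _.
rewrite /kap kappa_rec // rmorphB rmorphD rmorphM /= !rmorph_nat; ring.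
Qed.

Lemma Kfun_functional_equation (R : realType) (k : nat) (z : cplx R) :
  (1 < k)%N -> `|z| < 1 ->
  Kfun k z
    - (\sum_(0 <= a < k) (a + 1)%:R * z ^+ a) * Kfun k (z ^+ k)
    - (\sum_(0 <= a < k ^ 2) z ^+ a) * Kfun k (z ^+ (k ^ 2))
  = - \sum_(0 <= n < k) z ^+ n.
Proof.
move=> k1 z1; have k0 : (0 < k)%N by exact: ltnW.
have zX m : (0 < m)%N -> `|z ^+ m| < 1.
  by move=> m0; rewrite normrX exprn_ilt1 // -lt0n.
have lim_sub m (w : cplx R) : (0 < m)%N -> `|w| < 1 ->
    Kseries k w (m * N)%N @[N --> \oo] --> Kfun k w.
  move=> m0 w1.
  apply: (cvg_comp (muln m) (Kseries k w)); first exact: cvg_mulnl.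
  exact: Kseries_cvg.
have k20 : (0 < k ^ 2)%N by rewrite expn_gt0 k0.
have c1 := lim_sub _ _ k20 z1.
have c2 := lim_sub _ _ k0 (zX _ k0).
have c3 : Kseries k (z ^+ (k ^ 2)) N @[N --> \oo] --> Kfun k (z ^+ (k ^ 2)).
  exact: Kseries_cvg k1 (zX _ k20).
set P := \sum_(0 <= a < k) _; set Q := \sum_(0 <= a < k ^ 2) _.
have cP : P * Kseries k (z ^+ k) (k * N)%N @[N --> \oo] --> P * Kfun k (z ^+ k).
  by apply: cvgMl_tmp; exact: c2.
have cQ : Q * Kseries k (z ^+ (k ^ 2)) N @[N --> \oo] -->
    Q * Kfun k (z ^+ (k ^ 2)).
  by apply: cvgMl_tmp; exact: c3.
pose T N := Kseries k z (k ^ 2 * N)%N - P * Kseries k (z ^+ k) (k * N)%N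
    - Q * Kseries k (z ^+ (k ^ 2)) N.
have cL : T @ \oo -->
    Kfun k z - P * Kfun k (z ^+ k) - Q * Kfun k (z ^+ (k ^ 2)).
  exact: cvgB (cvgB c1 cP) cQ.
have cR : T @ \oo --> - \sum_(0 <= n < k) z ^+ n.
  (* [T] is constant only from [N = 1] on: at [N = 0] all partial sums are empty. *)
  apply: cvg_near_cst; exists 1%N => // N N0.
  exact: Kseries_functional_equation.
exact: (@cvg_unique _ (@norm_hausdorff _ (cplx R)) _ _ _ _ cL cR).
Qed.

Theorem theorem1 (k : nat) (hk : (2 <= k)%N) :
  (Kfps k
     - (\sum_(0 <= a < k) (a + 1)%:R * fpsX ^+ a) * fps_expand k (Kfps k)
     - (\sum_(0 <= a < k ^ 2) fpsX ^+ a) * fps_expand (k ^ 2) (Kfps k)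
   = - \sum_(0 <= n < k) fpsX ^+ n :> fps int)
  /\
  (forall (R : realType) (z : cplx R), `|z| < 1 ->
     cvgn (Kseries k z) /\
     Kfun k z
       - (\sum_(0 <= a < k) (a + 1)%:R * z ^+ a) * Kfun k (z ^+ k)
       - (\sum_(0 <= a < k ^ 2) z ^+ a) * Kfun k (z ^+ (k ^ 2))
     = - \sum_(0 <= n < k) z ^+ n).
Proof.
split; first exact: Kfps_functional_equation.
move=> R z z1; split; first exact: Kseries_cvg.
exact: Kfun_functional_equation.
Qed.
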